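(* Let $(B_1,\cdot,\circ)$ and $(B_2,\cdot,\circ)$ be isoclinic skew braces. Then: (1) if $B_1$ is a bi-skew brace, then $B_2$ is a bi-skew brace; (2) if $B_1$ is a $\lambda$-homomorphic skew brace, then $B_2$ is a $\lambda$-homomorphic skew brace; (3) if $B_1$ is an inner skew brace, then $B_2$ is an inner skew brace. That is, each of the properties of being bi-skew, $\lambda$-homomorphic, and inner is invariant under isoclinism of skew braces.
   Context: A (right) skew brace is a triple $(B,\cdot,\circ)$ where $(B,\cdot)$ and $(B,\circ)$ are groups (neither assumed abelian, nor finite) such that for all $x,y,z\in B$ $$((y\cdot z)\circ x)\cdot x^{-1}=\big((y\circ x)\cdot x^{-1}\big)\cdot\big((z\circ x)\cdot x^{-1}\big),$$ where $x^{-1}$ denotes the inverse in $(B,\cdot)$. Juxtaposition $xy$ means $x\cdot y$. Maps are written as exponents and composed from left to right. For $x\in B$ let $\gamma(x):B\to B$ be given by $y^{\gamma(x)}=(y\circ x)\cdot x^{-1}$. Each $\gamma(x)$ is an automorphism of $(B,\cdot)$, and the gamma function $\gamma:(B,\circ)\to\operatorname{Aut}(B,\cdot)$ is a group homomorphism (so $x^{\gamma(y\circ z)}=(x^{\gamma(y)})^{\gamma(z)}$). Morphisms of skew braces are maps that are homomorphisms for both operations $\cdot$ and $\circ$; an isomorphism is a bijective one. For $x,y\in B$ put $[x,y]=x^{-1}y^{-1}xy$ (inverses and products in $(B,\cdot)$) and $x*y=x^{-1}\cdot(x\circ y)\cdot y^{-1}=x^{-1}\cdot x^{\gamma(y)}$;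 the latter is also written $[x,\gamma(y)]$. The annihilator of $B$ is $$\operatorname{Ann}(B)=Z(B,\cdot)\cap\ker(\gamma)\cap\{x\in B: x^{\gamma(y)}=x\text{ for all }y\in B\}.$$ It is an ideal of $B$, so the quotient skew brace $B/\operatorname{Ann}(B)$ is defined. Let $B'$ be the subgroup $[B,B]\cdot[B,\gamma(B)]$ of $(B,\cdot)$, i.e. the subgroup of $(B,\cdot)$ generated by all elements $[x,y]$ and $x*y$ with $x,y\in B$; it is an ideal of $B$, in particular a skew brace under the restrictions of $\cdot$ and $\circ$. The values $[x,y]$ and $x*y$ depend only on the cosets $x\operatorname{Ann}(B)$ and $y\operatorname{Ann}(B)$. Isoclinism: two skew braces $(B_1,\cdot,\circ)$ and $(B_2,\cdot,\circ)$ are isoclinic if there exist skew brace isomorphisms $\xi:B_1/\operatorname{Ann}(B_1)\to B_2/\operatorname{Ann}(B_2)$ and $\vartheta:B_1'\to B_2'$ such that, for all $x,y\in B_1$ and all $u,v\in B_2$ with $(x\operatorname{Ann}(B_1))^{\xi}=u\operatorname{Ann}(B_2)$ and $(y\operatorname{Ann}(B_1))^{\xi}=v\operatorname{Ann}(B_2)$, one has $$[x,y]^{\vartheta}=[u,v]\qquad\text{and}\qquad (x*y)^{\vartheta}=u*v.$$ A skew brace $(B,\cdot,\circ)$ is: - a bi-skew brace if $(B,\circ,\cdot)$ (the two operations interchanged) is also a skew brace; - $\lambda$-homomorphic if $\gamma(x\cdot y)=\gamma(x)\gamma(y)$ for all $x,y\in B$, i.e. $\gamma$ is also a homomorphism $(B,\cdot)\to\operatorname{Aut}(B,\cdot)$;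 - inner if every $\gamma(y)$, $y\in B$, is an inner automorphism of $(B,\cdot)$, i.e. for each $y\in B$ there is $t\in B$ such that $x^{\gamma(y)}=t^{-1}xt$ for all $x\in B$. *)

(* Defs.v *)
From HB Require Import structures.
From mathcomp Require Import all_boot boolp.

Set Implicit Arguments.
Unset Strict Implicit.
Unset Printing Implicit Defensive.

Local Open Scope group_scope.
Local Open Scope quotient_scope.

Declare Scope brace_scope.
Delimit Scope brace_scope with brace.
Local Open Scope brace_scope.

Reserved Notation "x \circ y" (at level 40, left associativity).

(* The compatibility axiom for the ordered pair of operations (mul, circ),
   where inv is the inverse for mul; the operations are kept explicit so that
   they can be interchanged, see bi_skew below. *)
Definition skew_brace_axiom T (mul circ : T -> T -> T) (inv : T -> T) : Prop :=
  forall x y z,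
    mul (circ (mul y z) x) (inv x) =
    mul (mul (circ y x) (inv x)) (mul (circ z x) (inv x)).

(* The groupType structure on B is (B, .), written multiplicatively. The
   identity circ1 of (B, \circ) is not assumed to be 1; see circ1E. *)
HB.mixin Record Group_isSkewBrace B of Group B := {
  circ : B -> B -> B;
  circ1 : B;
  circV : B -> B;
  circA : associative circ;
  circ1x : left_id circ1 circ;
  circx1 : right_id circ1 circ;
  circVx : left_inverse circ1 circV circ;
  circxV : right_inverse circ1 circV circ;
  skew_braceP : skew_brace_axiom mul circ inv
}.

#[short(type="skewBraceType")]
HB.structure Definition SkewBrace := {B of Group_isSkewBrace B & Group B}.

Notation "x \circ y" := (circ x y) : brace_scope.

Section Operations.

Variable B : skewBraceType.
Implicit Types x y : B.

(* gamma x y is y^{gamma(x)}, so that the product gamma(x) gamma(y) of maps,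
   composed from left to right, is gamma y \o gamma x. *)
Definition gamma x y : B := (y \circ x) * x^-1.

Definition star x y : B := x^-1 * (x \circ y) * y^-1.

Definition ann : {pred B} := fun x =>
  `[< [/\ forall y, x * y = y * x,
          gamma x =1 id &
          forall y, gamma y x = x] >].

(* The intersection of all subgroups of (B, .) containing the elements [~ x, y]
   and star x y. *)
Definition derived : {pred B} := fun z =>
  `[< forall S : {pred B}, group_closed S ->
        (forall x y, [~ x, y] \in S) -> (forall x y, star x y \in S) ->
        z \in S >].

(* As (B, \circ) and (B, .) are groups, (B, \circ, .) is a skew brace as soon
   as the axiom holds with the operations interchanged. *)
Definition bi_skew : Prop := skew_brace_axiom (@circ B) mul (@circV B).

Definition lambda_homomorphic : Prop :=
  forall x y, gamma (x * y) =1 gamma y \o gamma x.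

(* x ^ t is the conjugate t^-1 * (x * t). *)
Definition inner : Prop :=
  forall y, exists t : B, forall x, gamma y x = x ^ t.

End Operations.

Arguments ann B : clear implicits.
Arguments derived B : clear implicits.
Arguments bi_skew B : clear implicits.
Arguments lambda_homomorphic B : clear implicits.
Arguments inner B : clear implicits.

Section SkewBraceTheory.

Variable B : skewBraceType.
Implicit Types x y z : B.

Lemma gammaM x y z : gamma x (y * z) = gamma x y * gamma x z.
Proof. exact: skew_braceP. Qed.

Lemma gamma1 x : gamma x 1 = 1.
Proof. by apply: (mulgI (gamma x 1)); rewrite -gammaM !mulg1. Qed.

Lemma gammaV x y : gamma x y^-1 = (gamma x y)^-1.
Proof. by apply: (mulgI (gamma x y)); rewrite -gammaM !mulgV gamma1. Qed.

Lemma circE x y : x \circ y = gamma y x * y.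
Proof. by rewrite /gamma mulgVK. Qed.

Lemma circ1E : circ1 = 1 :> B.
Proof. by rewrite -[RHS]circx1 circE gamma1 mul1g. Qed.

Lemma gamma_circ x y z : gamma (x \circ y) z = gamma y (gamma x z).
Proof.
have -> : gamma x z = (z \circ x) * x^-1 by [].
by rewrite gammaM gammaV /gamma circA invgM invgK !mulgA mulgVK.
Qed.

Lemma gamma_id x : gamma 1 x = x.
Proof. by rewrite /gamma -circ1E circx1 circ1E invg1 mulg1. Qed.

Lemma gammaK x : cancel (gamma x) (gamma (circV x)).
Proof. by move=> y; rewrite -gamma_circ circxV circ1E gamma_id. Qed.

Lemma starE x y : star x y = x^-1 * gamma y x.
Proof. by rewrite /star /gamma mulgA. Qed.

Lemma circVE x : circV x = gamma (circV x) x^-1.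
Proof.
have <- : gamma x (circV x) = x^-1 by rewrite /gamma circVx circ1E mul1g.
by rewrite gammaK.
Qed.

Lemma annP x :
  reflect [/\ forall y, x * y = y * x, gamma x =1 id & forall y, gamma y x = x]
          (x \in ann B).
Proof. exact: asboolP. Qed.

Lemma ann_group_closed : group_closed (ann B).
Proof.
have annM x y : x \in ann B -> y \in ann B -> x * y \in ann B.
  move=> /annP[cx kx fx] /annP[cy ky fy]; apply/annP; split=> z.
  - by rewrite -mulgA (cy z) mulgA (cx z) -mulgA.
  - have -> : x * y = x \circ y by rewrite circE fx.
    by rewrite gamma_circ ky kx.
  - by rewrite gammaM fx fy.
have annV x : x \in ann B -> x^-1 \in ann B.
  move=> /annP[cx kx fx]; apply/annP; split=> z.
  - by apply: (mulgI x); apply: (mulIg x);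
    rewrite mulVKg -!mulgA mulVg mulg1 cx.
  - by rewrite -[in LHS](kx z) -gamma_circ circE fx mulgV gamma_id.
  - by rewrite gammaV fx.
split=> [|x y Ax Ay]; last exact/annM/annV.
by apply/annP; split=> y; rewrite ?mul1g ?mulg1 ?gamma_id ?gamma1.
Qed.

(* This is x Ann(B) = y Ann(B). *)
Definition ann_rel : rel B := fun x y => x^-1 * y \in ann B.

Lemma ann_relP x y : reflect (exists2 a, a \in ann B & y = x * a) (ann_rel x y).
Proof.
apply: (iffP idP) => [xy | [a Aa ->]]; last by rewrite /ann_rel mulKg.
by exists (x^-1 * y); rewrite ?mulVKg.
Qed.

Lemma ann_equiv : equiv_class_of ann_rel.
Proof.
have [A1 AF] := ann_group_closed.
have AV := group_closedV ann_group_closed.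
have AM := group_closedM ann_group_closed.
split=> [x | x y | y x z]; rewrite /ann_rel; first by rewrite mulVg.
  by apply/idP/idP => /AV; rewrite invgM invgK.
by move=> xy yz; rewrite -(mulVKg y z) mulgA; apply: AM.
Qed.

Canonical ann_eqv := EquivRelPack ann_equiv.

End SkewBraceTheory.

Section AnnQuotient.

Variable B : skewBraceType.

Definition ann_quot := {eq_quot (ann_eqv B)}.

HB.instance Definition _ := EqQuotient.on ann_quot.
HB.instance Definition _ := Choice.on ann_quot.

Definition ann_quot_mul := lift_op2 ann_quot mul.
Definition ann_quot_inv := lift_op1 ann_quot inv.
Definition ann_quot_circ := lift_op2 ann_quot (@circ B).
Definition ann_quot_circV := lift_op1 ann_quot (@circV B).

Lemma ann_quot_eqP (x y : B) :
  reflect (exists2 a, a \in ann B & y = x * a)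
          (\pi_ann_quot x == \pi_ann_quot y).
Proof. by rewrite eqmodE; apply: ann_relP. Qed.

Lemma repr_piP (x : B) :
  exists2 a, a \in ann B & repr (\pi_ann_quot x) = x * a.
Proof. by apply/ann_quot_eqP; rewrite reprK. Qed.

Lemma ann_pi_mul (x y : B) :
  ann_quot_mul (\pi_ann_quot x) (\pi_ann_quot y) = \pi_ann_quot (x * y).
Proof.
rewrite /ann_quot_mul -lock.
have [a Aa ->] := repr_piP x; have [b Ab ->] := repr_piP y.
apply/esym/eqP/ann_quot_eqP; exists (a * b).
  exact: (group_closedM (@ann_group_closed B)).
by have /annP[ca _ _] := Aa; rewrite !mulgA -(mulgA x a) ca !mulgA.
Qed.

Lemma ann_pi_circ (x y : B) :
  ann_quot_circ (\pi_ann_quot x) (\pi_ann_quot y) = \pi_ann_quot (x \circ y).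
Proof.
rewrite /ann_quot_circ -lock.
have [a Aa ->] := repr_piP x; have [b Ab ->] := repr_piP y.
apply/esym/eqP/ann_quot_eqP; exists (a * b).
  exact: (group_closedM (@ann_group_closed B)).
have /annP[ca _ fa] := Aa; have /annP[cb kb fb] := Ab.
have gyb : gamma (y * b) =1 gamma y.
  move=> z; have -> : y * b = b \circ y by rewrite circE fb cb.
  by rewrite gamma_circ kb.
by rewrite !circE gyb gammaM fa !mulgA -(mulgA _ a y) (ca y) !mulgA.
Qed.

Lemma ann_pi_inv (x : B) : ann_quot_inv (\pi_ann_quot x) = \pi_ann_quot x^-1.
Proof.
rewrite /ann_quot_inv -lock; have [a Aa ->] := repr_piP x.
have AVa := group_closedV (@ann_group_closed B) Aa.
apply/esym/eqP/ann_quot_eqP; exists a^-1 => //.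
by have /annP[ca _ _] := AVa; rewrite invgM ca.
Qed.

Lemma ann_quot_mulA : associative ann_quot_mul.
Proof.
by apply: quotW => x; apply: quotW => y; apply: quotW => z;
rewrite !ann_pi_mul mulgA.
Qed.

Lemma ann_quot_mul1x : left_id (\pi_ann_quot 1) ann_quot_mul.
Proof. by apply: quotW => x; rewrite ann_pi_mul mul1g. Qed.

Lemma ann_quot_mulx1 : right_id (\pi_ann_quot 1) ann_quot_mul.
Proof. by apply: quotW => x; rewrite ann_pi_mul mulg1. Qed.

Lemma ann_quot_mulVx : left_inverse (\pi_ann_quot 1) ann_quot_inv ann_quot_mul.
Proof. by apply: quotW => x; rewrite ann_pi_inv ann_pi_mul mulVg. Qed.

Lemma ann_quot_mulxV : right_inverse (\pi_ann_quot 1) ann_quot_inv ann_quot_mul.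
Proof. by apply: quotW => x; rewrite ann_pi_inv ann_pi_mul mulgV. Qed.

HB.instance Definition _ := isGroup.Build ann_quot
  ann_quot_mulA ann_quot_mul1x ann_quot_mulx1 ann_quot_mulVx ann_quot_mulxV.

Lemma ann_quot_circA : associative ann_quot_circ.
Proof.
by apply: quotW => x; apply: quotW => y; apply: quotW => z;
rewrite !ann_pi_circ circA.
Qed.

Lemma ann_quot_circ1x : left_id (\pi_ann_quot circ1) ann_quot_circ.
Proof. by apply: quotW => x; rewrite ann_pi_circ circ1x. Qed.

Lemma ann_quot_circx1 : right_id (\pi_ann_quot circ1) ann_quot_circ.
Proof. by apply: quotW => x; rewrite ann_pi_circ circx1. Qed.

Lemma ann_quot_circVx :
  left_inverse (\pi_ann_quot circ1) ann_quot_circV ann_quot_circ.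
Proof.
move=> u; rewrite -[X in ann_quot_circ _ X]reprK /ann_quot_circV -lock.
by rewrite ann_pi_circ circVx.
Qed.

Lemma ann_quot_circxV :
  right_inverse (\pi_ann_quot circ1) ann_quot_circV ann_quot_circ.
Proof.
move=> u; rewrite -[X in ann_quot_circ X _]reprK /ann_quot_circV -lock.
by rewrite ann_pi_circ circxV.
Qed.

Lemma ann_quot_skew_braceP :
  skew_brace_axiom (@mul ann_quot) ann_quot_circ inv.
Proof.
apply: quotW => x; apply: quotW => y; apply: quotW => z.
rewrite -![mul]/ann_quot_mul -![inv]/ann_quot_inv.
by rewrite !(ann_pi_mul, ann_pi_circ, ann_pi_inv) skew_braceP.
Qed.

HB.instance Definition _ := Group_isSkewBrace.Build ann_quot
  ann_quot_circA ann_quot_circ1x ann_quot_circx1 ann_quot_circVx ann_quot_circxV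
  ann_quot_skew_braceP.

End AnnQuotient.

Section Derived.

Variable B : skewBraceType.
Implicit Types x y z : B.

Lemma derivedP z :
  reflect (forall S : {pred B}, group_closed S ->
             (forall x y, [~ x, y] \in S) -> (forall x y, star x y \in S) ->
             z \in S)
          (z \in derived B).
Proof. exact: asboolP. Qed.

Lemma comm_derived x y : [~ x, y] \in derived B.
Proof. by apply/derivedP=> S _ SR _. Qed.

Lemma star_derived x y : star x y \in derived B.
Proof. by apply/derivedP=> S _ _ Sst. Qed.

Lemma derived_group_closed : group_closed (derived B).
Proof.
split=> [|x y /derivedP Dx /derivedP Dy]; apply/derivedP=> S GS SR Sst.
  by case: GS.
by case: (GS) => _; apply; [apply: Dx | apply: Dy].
Qed.

Lemma gamma_derived x y : y \in derived B -> gamma x y \in derived B.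
Proof.
move=> Dy; have -> : gamma x y = y * star y x by rewrite starE mulVKg.
exact: (group_closedM derived_group_closed) (star_derived _ _).
Qed.

Lemma circ_derived x y :
  x \in derived B -> y \in derived B -> x \circ y \in derived B.
Proof.
move=> Dx Dy; rewrite circE.
exact: (group_closedM derived_group_closed) (gamma_derived _ Dx) Dy.
Qed.

Lemma circ1_derived : circ1 \in derived B.
Proof. by rewrite circ1E; case: derived_group_closed. Qed.

Lemma circV_derived x : x \in derived B -> circV x \in derived B.
Proof.
move=> Dx; rewrite circVE; apply: gamma_derived.
exact: (group_closedV derived_group_closed).
Qed.

Record derived_brace := DerivedBrace {
  derived_val :> B;
  derived_valP : derived_val \in derived B
}.

HB.instance Definition _ := [isSub for derived_val].
HB.instance Definition _ := [Choice of derived_brace by <:].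
HB.instance Definition _ := SubChoice_isSubGroup.Build B (derived B)
  derived_brace derived_group_closed.

Implicit Types u v : derived_brace.

Definition derived_circ u v :=
  DerivedBrace (circ_derived (derived_valP u) (derived_valP v)).
Definition derived_circ1 := DerivedBrace circ1_derived.
Definition derived_circV u := DerivedBrace (circV_derived (derived_valP u)).

Lemma derived_circA : associative derived_circ.
Proof. by move=> u v w; apply: val_inj; rewrite /= circA. Qed.

Lemma derived_circ1x : left_id derived_circ1 derived_circ.
Proof. by move=> u; apply: val_inj; rewrite /= circ1x. Qed.

Lemma derived_circx1 : right_id derived_circ1 derived_circ.
Proof. by move=> u; apply: val_inj; rewrite /= circx1. Qed.

Lemma derived_circVx : left_inverse derived_circ1 derived_circV derived_circ.
Proof. by move=> u; apply: val_inj; rewrite /= circVx. Qed.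

Lemma derived_circxV : right_inverse derived_circ1 derived_circV derived_circ.
Proof. by move=> u; apply: val_inj; rewrite /= circxV. Qed.

Lemma derived_skew_braceP : skew_brace_axiom mul derived_circ inv.
Proof.
by move=> u v w; apply: val_inj; rewrite !gmulfM !gmulfV /= skew_braceP.
Qed.

HB.instance Definition _ := Group_isSkewBrace.Build derived_brace
  derived_circA derived_circ1x derived_circx1 derived_circVx derived_circxV
  derived_skew_braceP.

Definition derived_comm x y := DerivedBrace (comm_derived x y).
Definition derived_star x y := DerivedBrace (star_derived x y).

End Derived.

Definition skew_brace_iso (A B : skewBraceType) (f : A -> B) : Prop :=
  [/\ {morph f : x y / x * y}, {morph f : x y / x \circ y} & bijective f].

(* xi (\pi x) = \pi u reads (x Ann(B1))^xi = u Ann(B2); derived_comm and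
   derived_star are [~ x, y] and star x y as elements of B'. *)
Definition isoclinic (B1 B2 : skewBraceType) : Prop :=
  exists (xi : ann_quot B1 -> ann_quot B2)
         (theta : derived_brace B1 -> derived_brace B2),
    [/\ skew_brace_iso xi, skew_brace_iso theta &
        forall (x y : B1) (u v : B2),
          xi (\pi_(ann_quot B1) x) = \pi_(ann_quot B2) u ->
          xi (\pi_(ann_quot B1) y) = \pi_(ann_quot B2) v ->
          theta (derived_comm x y) = derived_comm u v /\
          theta (derived_star x y) = derived_star u v].

(* Main.v *)
Require Import Defs.
From mathcomp Require Import all_boot.

(** An isoclinism transports every identity between commutators [~ x, y] and
stars x * y whose entries are prescribed modulo the annihilators. As
x * y = x^-1 x^gamma(y) and [~ x, t] = x^-1 x^t, it therefore transports the
relations gamma(y) = gamma(y') ([gamma_eq_transport]) and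
gamma(y) = conjugation by t ([gamma_conj_transport]). Each of the three
properties can be stated by such relations:
- inner means that every gamma(y) is the conjugation by some t;
- since gamma(x \circ y) = gamma(x) gamma(y), being lambda-homomorphic means
  gamma(x y) = gamma(x \circ y) for all x, y;
- being bi-skew means gamma(x y) = gamma(y \circ x) for all x, y, that is, gamma
  is an antihomomorphism on (B, .) ([bi_skewP]).
In the last two cases the products x y, x \circ y and y \circ x correspond to
the same products in the other brace, because the isomorphism between the
quotients respects both operations. *)

Set Implicit Arguments.
Unset Strict Implicit.
Unset Printing Implicit Defensive.

Local Open Scope group_scope.
Local Open Scope quotient_scope.
Local Open Scope brace_scope.

Section BiSkew.

Variable B : skewBraceType.
Implicit Types x y z : B.

Lemma circVK x : circV (circV x) = x.
Proof. by rewrite -[LHS]circ1x -(circxV x) -circA circxV circx1. Qed.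

Lemma gammaVK x : cancel (gamma (circV x)) (gamma x).
Proof. by move=> y; rewrite -gamma_circ circVx circ1E gamma_id. Qed.

(** The gamma function of (B, \circ, .) at x is the inverse of gamma(x):
if y = t^gamma(x), then y x = t \circ x. *)
Lemma gamma_swap x y : (y * x) \circ circV x = gamma (circV x) y.
Proof. by rewrite -[in LHS](gammaVK x y) -circE -circA circxV circx1. Qed.

Lemma bi_skew_gamma_circ :
  bi_skew B <-> forall x y z, gamma x (y \circ z) = gamma x y \circ gamma x z.
Proof.
split=> [bi x y z | gamma_endo x y z]; last by rewrite !gamma_swap gamma_endo.
by have := bi (circV x) y z; rewrite !gamma_swap circVK.
Qed.

(** Expanding \circ by gamma, gamma(x) is an endomorphism of (B, \circ) iff
gamma(z) gamma(x) = gamma(x) gamma(z^gamma(x)) for all z. The left side is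
gamma(z \circ x) = gamma(z^gamma(x) x), where z^gamma(x) is an arbitrary
element, while the right side is gamma(x \circ z^gamma(x)). *)
Lemma bi_skewP :
  bi_skew B <-> forall x y, gamma (x * y) =1 gamma (y \circ x).
Proof.
rewrite bi_skew_gamma_circ; split=> [gamma_endo x y z | anti x y z].
  have -> : x * y = gamma (circV y) x \circ y by rewrite circE gammaVK.
  have := gamma_endo y z (gamma (circV y) x).
  rewrite [z \circ _]circE [RHS]circE gammaM gammaVK => /mulIg.
  by rewrite !gamma_circ.
by rewrite [y \circ z]circE [RHS]circE gammaM -!gamma_circ -[in RHS]anti -circE.
Qed.

End BiSkew.

Lemma lambda_homomorphicP (B : skewBraceType) :
  lambda_homomorphic B <-> forall x y : B, gamma (x * y) =1 gamma (x \circ y).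
Proof. by split=> lam x y z; rewrite lam /= gamma_circ. Qed.

Section Transport.

Variables B1 B2 : skewBraceType.
Variable xi : ann_quot B1 -> ann_quot B2.
Variable theta : derived_brace B1 -> derived_brace B2.
Hypothesis xi_iso : skew_brace_iso xi.
Hypothesis xi_theta : forall (x y : B1) (u v : B2),
  xi (\pi_(ann_quot B1) x) = \pi_(ann_quot B2) u ->
  xi (\pi_(ann_quot B1) y) = \pi_(ann_quot B2) v ->
  theta (derived_comm x y) = derived_comm u v /\
  theta (derived_star x y) = derived_star u v.

Definition corresponds (x : B1) (u : B2) : Prop :=
  xi (\pi_(ann_quot B1) x) = \pi_(ann_quot B2) u.

Lemma corresponds_surj u : exists x, corresponds x u.
Proof.
have [_ _ [xi' _ xi'K]] := xi_iso.
by exists (repr (xi' (\pi u))); rewrite /corresponds reprK xi'K.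
Qed.

Lemma corresponds_total x : exists u, corresponds x u.
Proof. by exists (repr (xi (\pi x))); rewrite /corresponds reprK. Qed.

Lemma correspondsM x y u v :
  corresponds x u -> corresponds y v -> corresponds (x * y) (u * v).
Proof.
have [xiM _ _] := xi_iso; rewrite /corresponds => xu yv.
by rewrite -!ann_pi_mul -xu -yv; exact: xiM.
Qed.

Lemma corresponds_circ x y u v :
  corresponds x u -> corresponds y v -> corresponds (x \circ y) (u \circ v).
Proof.
have [_ xiC _] := xi_iso; rewrite /corresponds => xu yv.
by rewrite -!ann_pi_circ -xu -yv; exact: xiC.
Qed.

Lemma gamma_eq_transport y y' v v' :
  corresponds y v -> corresponds y' v' ->
  gamma y =1 gamma y' -> gamma v =1 gamma v'.
Proof.
move=> yv yv' eq_gamma u; have [x xu] := corresponds_surj u.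
have [_ star_yv] := xi_theta xu yv; have [_ star_yv'] := xi_theta xu yv'.
have eq_star : derived_star x y = derived_star x y'.
  by apply: val_inj; rewrite /= !starE eq_gamma.
move: star_yv; rewrite eq_star star_yv' => /(congr1 val) /=.
by rewrite !starE => /mulgI.
Qed.

Lemma gamma_conj_transport y t v s :
  corresponds y v -> corresponds t s ->
  (forall x, gamma y x = x ^ t) -> forall u, gamma v u = u ^ s.
Proof.
move=> yv ts eq_conj u; have [x xu] := corresponds_surj u.
have [_ star_yv] := xi_theta xu yv; have [comm_ts _] := xi_theta xu ts.
have eq_star : derived_star x y = derived_comm x t.
  by apply: val_inj; rewrite /= starE eq_conj.
move: star_yv; rewrite eq_star comm_ts => /(congr1 val) /=.
by rewrite starE => /mulgI.
Qed.

Lemma inner_transport : inner B1 -> inner B2.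
Proof.
move=> inn v; have [y yv] := corresponds_surj v.
have [t eq_conj] := inn y; have [s ts] := corresponds_total t.
by exists s; apply: gamma_conj_transport eq_conj.
Qed.

Lemma lambda_homomorphic_transport :
  lambda_homomorphic B1 -> lambda_homomorphic B2.
Proof.
rewrite !lambda_homomorphicP => lam u v.
have [x xu] := corresponds_surj u; have [y yv] := corresponds_surj v.
exact: gamma_eq_transport (correspondsM xu yv) (corresponds_circ xu yv) _.
Qed.

Lemma bi_skew_transport : bi_skew B1 -> bi_skew B2.
Proof.
rewrite !bi_skewP => anti u v.
have [x xu] := corresponds_surj u; have [y yv] := corresponds_surj v.
exact: gamma_eq_transport (correspondsM xu yv) (corresponds_circ yv xu) _.
Qed.

End Transport.

Theorem mainTheorem1 (B1 B2 : skewBraceType) (iso12 : isoclinic B1 B2) :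
  [/\ bi_skew B1 -> bi_skew B2,
      lambda_homomorphic B1 -> lambda_homomorphic B2 &
      inner B1 -> inner B2].
Proof.
have [xi [theta [xi_iso _ xi_theta]]] := iso12.
split.
- exact: bi_skew_transport xi_iso xi_theta.
- exact: lambda_homomorphic_transport xi_iso xi_theta.
- exact: inner_transport xi_iso xi_theta.
Qed.
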